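(* Let $\gamma$ be a smooth unit speed curve in $E^3$ with Bishop frame $\{T,N_1,N_2\}$, Bishop curvatures $k_1,k_2$, and $\kappa=\sqrt{k_1^2+k_2^2}>0$. Let $\chi(s,v)=\frac{N_1(s)+N_2(s)}{\sqrt2}+v\,T(s)$ be the $N_1N_2$ Smarandache ruled surface, with unit normal $n=\frac{k_2N_1-k_1N_2}{\kappa}$. At every point $(s,v)$ with $v\neq0$, the Gaussian curvature $K$ and the mean curvature $H$ of $\chi$ are $$K=0,\qquad H=\frac{k_1'k_2-k_1k_2'}{2v\,\kappa^3}.$$
   Context: $E^3$ is Euclidean 3-space with inner product $\langle\cdot,\cdot\rangle$. A Bishop frame of a smooth unit speed curve $\gamma=\gamma(s)$ is a smooth positively oriented orthonormal frame $\{T,N_1,N_2\}$ along $\gamma$ with $T=\gamma'$ and $T'=k_1N_1+k_2N_2$, $N_1'=-k_1T$, $N_2'=-k_2T$, where $k_1,k_2$ are smooth functions of $s$ (the Bishop curvatures) and $'=d/ds$. For a surface $\chi(s,v)$ with unit normal field $n$, put $E=\langle\chi_s,\chi_s\rangle$, $F=\langle\chi_s,\chi_v\rangle$, $G=\langle\chi_v,\chi_v\rangle$, $L=\langle\chi_{ss},n\rangle$, $M=\langle\chi_{sv},n\rangle$, $N=\langle\chi_{vv},n\rangle$. Then $K=\frac{LN-M^2}{EG-F^2}$ and $H=\frac{EN-2MF+LG}{2(EG-F^2)}$. *)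

(* Defs.v *)
From HB Require Import structures.
From mathcomp Require Import all_boot all_order all_algebra.
From mathcomp Require Import all_classical all_reals all_analysis.
From mathcomp Require Import ring lra.

Set Implicit Arguments.
Unset Strict Implicit.
Unset Printing Implicit Defensive.

Import Order.TTheory GRing.Theory Num.Theory.
Import numFieldNormedType.Exports.

Local Open Scope classical_set_scope.
Local Open Scope ring_scope.

(* E^3 is 'rV[R]_3. The library norm on 'rV[R]_3 is the sup norm; it only
   serves to take derivatives, which do not depend on the choice of a norm. *)
Definition dot3 (R : realType) (u w : 'rV[R]_3) : R :=
  \sum_(i < 3) u ord0 i * w ord0 i.

Definition smooth_on (R : realType) (V : normedModType R)
    (I : set R) (f : R -> V) : Prop :=
  forall (n : nat) (s : R), I s -> derivable (derive1n n f) s 1.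

Definition positive_orthonormal (R : realType) (e1 e2 e3 : 'rV[R]_3) : Prop :=
  [/\ [/\ dot3 e1 e1 = 1, dot3 e2 e2 = 1 & dot3 e3 e3 = 1],
      [/\ dot3 e1 e2 = 0, dot3 e1 e3 = 0 & dot3 e2 e3 = 0] &
      0 < \det (\matrix_(i < 3) [:: e1; e2; e3]`_i)].

(* Curves are total functions, but only their values on the open interval I
   matter: a derivative at a point of I is local. *)
Definition smooth_unit_speed (R : realType) (I : set R)
    (gamma : R -> 'rV[R]_3) : Prop :=
  smooth_on I gamma /\
  (forall s, I s -> dot3 (derive1 gamma s) (derive1 gamma s) = 1).

Record bishop_frame (R : realType) (I : set R) (gamma : R -> 'rV[R]_3)
    (T N1 N2 : R -> 'rV[R]_3) (k1 k2 : R -> R) : Prop := BishopFrame {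
  bishop_smoothT : smooth_on I T;
  bishop_smoothN1 : smooth_on I N1;
  bishop_smoothN2 : smooth_on I N2;
  bishop_smooth_k1 : smooth_on I k1;
  bishop_smooth_k2 : smooth_on I k2;
  bishop_orthonormal :
    forall s, I s -> positive_orthonormal (T s) (N1 s) (N2 s);
  bishop_tangent : forall s, I s -> T s = derive1 gamma s;
  bishop_dT : forall s, I s -> derive1 T s = k1 s *: N1 s + k2 s *: N2 s;
  bishop_dN1 : forall s, I s -> derive1 N1 s = - k1 s *: T s;
  bishop_dN2 : forall s, I s -> derive1 N2 s = - k2 s *: T s
}.

Definition bishop_kappa (R : realType) (k1 k2 : R -> R) (s : R) : R :=
  Num.sqrt (k1 s ^+ 2 + k2 s ^+ 2).

Definition partial_s (R : realType) (V : normedModType R)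
    (f : R -> R -> V) : R -> R -> V := fun s v => derive1 (fun t => f t v) s.

Definition partial_v (R : realType) (V : normedModType R)
    (f : R -> R -> V) : R -> R -> V := fun s v => derive1 (f s) v.

Section Surface.
Variables (R : realType) (chi n : R -> R -> 'rV[R]_3).

Definition coefE s v := dot3 (partial_s chi s v) (partial_s chi s v).
Definition coefF s v := dot3 (partial_s chi s v) (partial_v chi s v).
Definition coefG s v := dot3 (partial_v chi s v) (partial_v chi s v).

Definition coefL s v := dot3 (partial_s (partial_s chi) s v) (n s v).
Definition coefM s v := dot3 (partial_v (partial_s chi) s v) (n s v).
Definition coefN s v := dot3 (partial_v (partial_v chi) s v) (n s v).

Definition gauss_curvature s v : R :=
  (coefL s v * coefN s v - coefM s v ^+ 2) /
  (coefE s v * coefG s v - coefF s v ^+ 2).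

Definition mean_curvature s v : R :=
  (coefE s v * coefN s v - 2 * coefM s v * coefF s v + coefL s v * coefG s v) /
  (2 * (coefE s v * coefG s v - coefF s v ^+ 2)).

Definition unit_normal_at s v : Prop :=
  [/\ dot3 (n s v) (n s v) = 1, dot3 (n s v) (partial_s chi s v) = 0 &
      dot3 (n s v) (partial_v chi s v) = 0].

End Surface.

Definition smarandache_N1N2 (R : realType) (T N1 N2 : R -> 'rV[R]_3)
    (s v : R) : 'rV[R]_3 :=
  (Num.sqrt 2)^-1 *: (N1 s + N2 s) + v *: T s.

Definition smarandache_normal (R : realType) (N1 N2 : R -> 'rV[R]_3)
    (k1 k2 : R -> R) (s v : R) : 'rV[R]_3 :=
  (bishop_kappa k1 k2 s)^-1 *: (k2 s *: N1 s - k1 s *: N2 s).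

Lemma dot3C (R : realType) (u w : 'rV[R]_3) : dot3 u w = dot3 w u.
Proof. by apply: eq_bigr => i _; rewrite mulrC. Qed.

Lemma dot3Dl (R : realType) (u u' w : 'rV[R]_3) :
  dot3 (u + u') w = dot3 u w + dot3 u' w.
Proof.
by rewrite /dot3 -big_split; apply: eq_bigr => i _; rewrite mxE mulrDl.
Qed.

Lemma dot3Zl (R : realType) (a : R) (u w : 'rV[R]_3) :
  dot3 (a *: u) w = a * dot3 u w.
Proof. by rewrite /dot3 mulr_sumr; apply: eq_bigr => i _; rewrite mxE mulrA. Qed.

Lemma dot3Nl (R : realType) (u w : 'rV[R]_3) : dot3 (- u) w = - dot3 u w.
Proof. by rewrite -scaleN1r dot3Zl mulN1r. Qed.

Lemma dot3Dr (R : realType) (u w w' : 'rV[R]_3) :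
  dot3 u (w + w') = dot3 u w + dot3 u w'.
Proof. by rewrite dot3C dot3Dl !(dot3C u). Qed.

Lemma dot3Zr (R : realType) (a : R) (u w : 'rV[R]_3) :
  dot3 u (a *: w) = a * dot3 u w.
Proof. by rewrite dot3C dot3Zl dot3C. Qed.

Lemma dot3Nr (R : realType) (u w : 'rV[R]_3) : dot3 u (- w) = - dot3 u w.
Proof. by rewrite dot3C dot3Nl dot3C. Qed.

Lemma smarandache_partial_s (R : realType) (I : set R)
    (gamma T N1 N2 : R -> 'rV[R]_3) (k1 k2 : R -> R) (s v : R) :
  bishop_frame I gamma T N1 N2 k1 k2 -> I s ->
  partial_s (smarandache_N1N2 T N1 N2) s v =
  (Num.sqrt 2)^-1 *: (- k1 s *: T s + - k2 s *: T s)
  + v *: (k1 s *: N1 s + k2 s *: N2 s).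
Proof.
move=> hB Is.
have dT : derivable T s 1 by exact: (@bishop_smoothT _ _ _ _ _ _ _ _ hB 0%N).
have dN1 : derivable N1 s 1 by exact: (@bishop_smoothN1 _ _ _ _ _ _ _ _ hB 0%N).
have dN2 : derivable N2 s 1 by exact: (@bishop_smoothN2 _ _ _ _ _ _ _ _ hB 0%N).
rewrite -(bishop_dT hB Is) -(bishop_dN1 hB Is) -(bishop_dN2 hB Is).
rewrite /partial_s !derive1E.
have dN : is_derive s (1 : R) (N1 + N2) ('D_1 N1 s + 'D_1 N2 s).
  exact: is_deriveD (derivableP dN1) (derivableP dN2).
have dNZ := is_deriveZ (Num.sqrt 2)^-1 dN.
have dTZ := is_deriveZ v (derivableP dT).
by have [_ <-] := is_deriveD dNZ dTZ.
Qed.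

Lemma smarandache_partial_v (R : realType) (T N1 N2 : R -> 'rV[R]_3) (s v : R) :
  partial_v (smarandache_N1N2 T N1 N2) s v = T s.
Proof.
rewrite /partial_v derive1E.
have dT : is_derive v (1 : R) ( *:%R ^~ (T s)) (T s).
  by apply: DeriveDef; [exact/diff_derivable|rewrite deriveE // diff_val scale1r].
have dN := is_derive_cst ((Num.sqrt 2)^-1 *: (N1 s + N2 s)) v (1 : R).
by have [_] := is_deriveD dN dT; rewrite add0r.
Qed.

Lemma smarandache_unit_normal (R : realType) (I : set R)
    (gamma T N1 N2 : R -> 'rV[R]_3) (k1 k2 : R -> R) (s v : R) :
  bishop_frame I gamma T N1 N2 k1 k2 -> I s -> 0 < bishop_kappa k1 k2 s ->
  unit_normal_at (smarandache_N1N2 T N1 N2) (smarandache_normal N1 N2 k1 k2) s v.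
Proof.
move=> hB Is k0; rewrite /unit_normal_at (smarandache_partial_s _ hB Is).
rewrite smarandache_partial_v /smarandache_normal.
have [[T1 N11 N21] [TN1 TN2 N12] _] := bishop_orthonormal hB Is.
have hk : bishop_kappa k1 k2 s ^+ 2 = k1 s ^+ 2 + k2 s ^+ 2.
  by rewrite sqr_sqrtr // addr_ge0 ?sqr_ge0.
have k0' : bishop_kappa k1 k2 s != 0 by rewrite gt_eqF.
set k := bishop_kappa k1 k2 s in hk k0' *.
have [NT1 NT2 N2N1] : [/\ dot3 (N1 s) (T s) = 0, dot3 (N2 s) (T s) = 0 &
    dot3 (N2 s) (N1 s) = 0] by rewrite !(dot3C (N2 s)) (dot3C (N1 s)).
split; rewrite !(dot3Dl, dot3Dr, dot3Zl, dot3Zr, dot3Nl, dot3Nr)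
  ?(N11, N21, N12, N2N1, NT1, NT2).
- transitivity (k ^- 2 * (k1 s ^+ 2 + k2 s ^+ 2)); first by field.
  by rewrite -hk mulVf ?expf_neq0.
- by ring.
- by ring.
Qed.

Lemma smarandache_regular (R : realType) (I : set R)
    (gamma T N1 N2 : R -> 'rV[R]_3) (k1 k2 : R -> R) (s v : R) :
  bishop_frame I gamma T N1 N2 k1 k2 -> I s ->
  let chi := smarandache_N1N2 T N1 N2 in
  coefE chi s v * coefG chi s v - coefF chi s v ^+ 2 =
  v ^+ 2 * bishop_kappa k1 k2 s ^+ 2.
Proof.
move=> hB Is chi.
rewrite /coefE /coefF /coefG (smarandache_partial_s _ hB Is).
rewrite smarandache_partial_v.
have [[T1 N11 N21] [TN1 TN2 N12] _] := bishop_orthonormal hB Is.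
have hk : bishop_kappa k1 k2 s ^+ 2 = k1 s ^+ 2 + k2 s ^+ 2.
  by rewrite sqr_sqrtr // addr_ge0 ?sqr_ge0.
have [NT1 NT2 N2N1] : [/\ dot3 (N1 s) (T s) = 0, dot3 (N2 s) (T s) = 0 &
    dot3 (N2 s) (N1 s) = 0] by rewrite !(dot3C (N2 s)) (dot3C (N1 s)).
rewrite !(dot3Dl, dot3Dr, dot3Zl, dot3Zr)
  ?(T1, TN1, TN2, N11, N21, N12, N2N1, NT1, NT2) hk.
by ring.
Qed.

(* Main.v *)
Require Import Defs.
From mathcomp Require Import all_boot all_order all_algebra.
From mathcomp Require Import all_classical all_reals all_analysis.
From mathcomp Require Import ring.

Import Order.TTheory GRing.Theory Num.Theory.
Import numFieldNormedType.Exports.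

Local Open Scope classical_set_scope.
Local Open Scope ring_scope.

(* The vector T' = k1 N1 + k2 N2 is orthogonal to n, so chi_v = T gives
   M = <T', n> = 0 and N = 0, hence K = 0.  Since G = 1, the mean curvature is
   L / (2 (E G - F ^ 2)) with E G - F ^ 2 = v ^ 2 kappa ^ 2, and
   L = v <T'', n> because N1' and N2' are multiples of T. *)

(** Product rule for a scalar function times a curve; it is what differentiates terms such as
    [k1 t *: T t], where both factors vary. *)
Lemma is_derive_scale {R : realType} {W : normedModType R} {f : R -> R}
    {g : R -> W} {x df : R} {dg : W} :
  is_derive x (1 : R) f df -> is_derive x (1 : R) g dg ->
  is_derive x (1 : R) (fun t => f t *: g t) (f x *: dg + df *: g x).
Proof.
move=> [f1 <-] [g1 <-].
suff fg : h^-1 *: (f (h *: 1 + x) *: g (h *: 1 + x) - f x *: g x)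
    @[h --> 0^'] --> f x *: 'D_1 g x + 'D_1 f x *: g x.
  by apply: DeriveDef; [apply/cvg_ex; eexists; exact: fg | exact: cvg_lim fg].
(* Insert and remove [f (h *: 1 + x) *: g x], so that each summand contains a single difference
   quotient. *)
have -> : (fun h => h^-1 *: (f (h *: 1 + x) *: g (h *: 1 + x) - f x *: g x)) =
    (fun h => f (h *: 1 + x) *: (h^-1 *: (g (h *: 1 + x) - g x)) +
      (h^-1 *: (f (h *: 1 + x) - f x)) *: g x).
  apply/funext => h; set f' := f (_ + _); set g' := g (_ + _).
  rewrite !scalerBr scalerBl !scalerA /GRing.scale /= (mulrC f').
  by rewrite subrKA.
apply: cvgD; last by apply: cvgZr_tmp; exact: f1.
apply: cvgZ; last exact: g1.
(* The factor [f (h *: 1 + x)] tends to [f x] because a derivable function is continuous. *)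
suff : {for 0, continuous (fun h : R => f (h *: 1 + x))}.
  by move=> /continuous_withinNx; rewrite scale0r add0r.
exact/differentiable_continuous/derivable1_diffP/(derivable1P _ _ _).1.
Qed.

(** Differentiate the formula for chi_s by the product rule, then eliminate T', N1' and N2' by the
    Bishop equations. *)
Lemma smarandache_partial_ss {R : realType} {I : set R}
    {gamma T N1 N2 : R -> 'rV[R]_3} {k1 k2 : R -> R} {s : R} (v : R) :
  open I -> bishop_frame I gamma T N1 N2 k1 k2 -> I s ->
  partial_s (partial_s (smarandache_N1N2 T N1 N2)) s v =
  (- (v * (k1 s ^+ 2 + k2 s ^+ 2)) -
     (Num.sqrt 2)^-1 * (derive1 k1 s + derive1 k2 s)) *: T s
  - ((Num.sqrt 2)^-1 * (k1 s + k2 s)) *: (k1 s *: N1 s + k2 s *: N2 s)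
  + v *: (derive1 k1 s *: N1 s + derive1 k2 s *: N2 s).
Proof.
move=> oI hB Is; set c := (Num.sqrt 2)^-1.
have dT : is_derive s (1 : R) T (k1 s *: N1 s + k2 s *: N2 s).
  rewrite -(bishop_dT hB Is) derive1E.
  exact/derivableP/(@bishop_smoothT _ _ _ _ _ _ _ _ hB 0%N).
have dN1 : is_derive s (1 : R) N1 (- k1 s *: T s).
  rewrite -(bishop_dN1 hB Is) derive1E.
  exact/derivableP/(@bishop_smoothN1 _ _ _ _ _ _ _ _ hB 0%N).
have dN2 : is_derive s (1 : R) N2 (- k2 s *: T s).
  rewrite -(bishop_dN2 hB Is) derive1E.
  exact/derivableP/(@bishop_smoothN2 _ _ _ _ _ _ _ _ hB 0%N).
have dk1 : is_derive s (1 : R) k1 (derive1 k1 s).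
  by rewrite derive1E; exact/derivableP/(@bishop_smooth_k1 _ _ _ _ _ _ _ _ hB 0%N).
have dk2 : is_derive s (1 : R) k2 (derive1 k2 s).
  by rewrite derive1E; exact/derivableP/(@bishop_smooth_k2 _ _ _ _ _ _ _ _ hB 0%N).
have dNs := is_deriveZ c (is_deriveD (is_derive_scale (is_deriveN dk1) dT)
  (is_derive_scale (is_deriveN dk2) dT)).
have dTs := is_deriveZ v (is_deriveD (is_derive_scale dk1 dN1)
  (is_derive_scale dk2 dN2)).
have dchi := is_deriveD dNs dTs.
rewrite /partial_s derive1E.
(* The formula for chi_s is known only on [I]; as [I] is open, it holds near [s], which suffices for
   the derivative there. *)
have -> : 'D_1 (fun t => partial_s (smarandache_N1N2 T N1 N2) t v) s =
    'D_1 (fun t => c *: (- k1 t *: T t + - k2 t *: T t)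
      + v *: (k1 t *: N1 t + k2 t *: N2 t)) s.
  apply: near_eq_derive; near=> t; apply: (smarandache_partial_s _ hB).
  by near: t; exact: open_nbhs_nbhs.
have [_ ->] := dchi.
by apply/rowP => i; rewrite !(mxE, fctE); ring.
Unshelve. all: by end_near. Qed.

Lemma smarandache_partial_sv {R : realType} {I : set R}
    {gamma T N1 N2 : R -> 'rV[R]_3} {k1 k2 : R -> R} {s : R} (v : R) :
  bishop_frame I gamma T N1 N2 k1 k2 -> I s ->
  partial_v (partial_s (smarandache_N1N2 T N1 N2)) s v =
  k1 s *: N1 s + k2 s *: N2 s.
Proof.
move=> hB Is.
set w := k1 s *: N1 s + k2 s *: N2 s.
(* For fixed [s], chi_s is affine in [v] with direction [w]. It is thus a ruling of a Smarandache
   surface built from constant fields, and the earlier formula for the [v]-derivative applies. *)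
have -> : partial_v (partial_s (smarandache_N1N2 T N1 N2)) s v =
    partial_v (smarandache_N1N2 (fun=> w)
      (fun=> - k1 s *: T s) (fun=> - k2 s *: T s)) s v.
  congr (derive1 _ v); apply/funext => u.
  exact: smarandache_partial_s hB Is.
exact: smarandache_partial_v.
Qed.

Lemma smarandache_partial_vv (R : realType) (T N1 N2 : R -> 'rV[R]_3)
    (s v : R) :
  partial_v (partial_v (smarandache_N1N2 T N1 N2)) s v = 0.
Proof.
rewrite {1}/partial_v.
have -> : partial_v (smarandache_N1N2 T N1 N2) s = cst (T s).
  by apply/funext => u; exact: smarandache_partial_v.
by rewrite derive1_cst.
Qed.

Section SecondFundamentalForm.
Context {R : realType} {I : set R} {gamma T N1 N2 : R -> 'rV[R]_3}.
Context {k1 k2 : R -> R} {s : R} (v : R).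
Hypotheses (frame : bishop_frame I gamma T N1 N2 k1 k2) (Is : I s).

Let chi := smarandache_N1N2 T N1 N2.
Let n := smarandache_normal N1 N2 k1 k2.

(** The normal has no component along T, so the T-coordinate drops out; L and M are read off from
    the frame coordinates of chi_ss and chi_sv. *)
Lemma smarandache_normal_frame (a b c : R) :
  dot3 (a *: T s + b *: N1 s + c *: N2 s) (n s v) =
  (b * k2 s - c * k1 s) / bishop_kappa k1 k2 s.
Proof.
have [[_ N11 N21] [TN1 TN2 N12] _] := bishop_orthonormal frame Is.
have N2N1 : dot3 (N2 s) (N1 s) = 0 by rewrite dot3C.
rewrite /n /smarandache_normal.
rewrite !(dot3Dl, dot3Dr, dot3Zl, dot3Zr, dot3Nl, dot3Nr).
rewrite N11 N21 TN1 TN2 N12 N2N1; ring.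
Qed.

Lemma smarandache_coefL : open I ->
  Defs.coefL chi n s v =
  v * (derive1 k1 s * k2 s - k1 s * derive1 k2 s) / bishop_kappa k1 k2 s.
Proof.
move=> oI; rewrite /Defs.coefL (smarandache_partial_ss _ oI frame Is).
(* Here [c] multiplies T' in chi_ss. Since T' is orthogonal to the normal, the [c] terms cancel, as
   does [a]. *)
set a := (X in X *: T s); set c := _^-1 * _.
rewrite [X in dot3 X _](_ : _ = a *: T s
  + (v * derive1 k1 s - c * k1 s) *: N1 s
  + (v * derive1 k2 s - c * k2 s) *: N2 s).
  rewrite smarandache_normal_frame; ring.
by apply/rowP => i; rewrite !mxE; ring.
Qed.

Lemma smarandache_coefM : Defs.coefM chi n s v = 0.
Proof.
rewrite /Defs.coefM (smarandache_partial_sv _ frame Is).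
(* Supply a zero T-coordinate, so that chi_sv has the shape of a full frame expansion. *)
rewrite -[X in X + _]add0r -(scale0r (T s)) smarandache_normal_frame; ring.
Qed.

Lemma smarandache_coefN : Defs.coefN chi n s v = 0.
Proof. by rewrite /Defs.coefN smarandache_partial_vv -(scale0r 0) dot3Zl mul0r. Qed.

Lemma smarandache_coefG : Defs.coefG chi s v = 1.
Proof.
rewrite /Defs.coefG smarandache_partial_v.
by have [[]] := bishop_orthonormal frame Is.
Qed.

End SecondFundamentalForm.

Theorem theorem3p7 (R : realType) (I : set R) (gamma T N1 N2 : R -> 'rV[R]_3)
    (k1 k2 : R -> R)
    (openI : open I) (intervalI : is_interval I)
    (gamma_unit : smooth_unit_speed I gamma)
    (frame : bishop_frame I gamma T N1 N2 k1 k2)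
    (kappa_gt0 : forall s, I s -> 0 < bishop_kappa k1 k2 s)
    (s v : R) (Is : I s) (v_neq0 : v <> 0) :
  let chi := smarandache_N1N2 T N1 N2 in
  let n := smarandache_normal N1 N2 k1 k2 in
  gauss_curvature chi n s v = 0 /\
  mean_curvature chi n s v =
    (derive1 k1 s * k2 s - k1 s * derive1 k2 s) /
    (2 * v * bishop_kappa k1 k2 s ^+ 3).
Proof.
move=> chi n; rewrite /gauss_curvature /mean_curvature.
rewrite (smarandache_coefM v frame Is) smarandache_coefN.
rewrite (smarandache_coefG v frame Is) (smarandache_coefL v frame Is openI).
have := smarandache_regular v frame Is.
rewrite /= (smarandache_coefG v frame Is) -/chi => ->.
have v0 : v != 0 by apply/eqP.
have k0 : bishop_kappa k1 k2 s != 0 by rewrite gt_eqF ?kappa_gt0.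
(* With M = N = 0 the numerator of K vanishes. *)
split; first by ring.
(* What remains is L / (2 v^2 kappa^2): the factor [v] of L cancels one power of [v], and its
   denominator kappa raises the exponent to 3. *)
by field; rewrite v0 k0.
Qed.
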